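(* Let $k<m$ be positive integers such that either $\gcd(k,m)=1$, or $m$ is even and $k=\frac{m}{2}$. Then the Toeplitz graph $G_n(1^{k-1}01^{m-k})$ is word-representable for every positive integer $n$.
   Context: For a word $a_1a_2\cdots a_p$ over $\{0,1\}$, the Toeplitz graph $G_n(a_1a_2\cdots a_p)$ is the simple graph on vertex set $[n]=\{1,\dots,n\}$ in which distinct vertices $x,y$ are adjacent if and only if $a_r=1$, where $r\in[p]$ is such that $r\equiv |x-y|\pmod p$. (Equivalently it is the Riordan graph $G_n\big(\frac{a_1+a_2z+\cdots+a_pz^{p-1}}{1-z^p},z\big)$.) For a letter $c$, $c^j$ denotes $c$ repeated $j$ times, so $1^{k-1}01^{m-k}$ is the word of length $m$ with a single $0$ in position $k$ and $1$ elsewhere; thus $x\sim y$ in $G_n(1^{k-1}01^{m-k})$ iff $|x-y|\not\equiv k\pmod m$. Two distinct letters $x,y$ alternate in a word $w$ if deleting all other letters from $w$ yields a word of the form $xyxy\cdots$ or $yxyx\cdots$ (of even or odd length). A graph $G=(V,E)$ is word-representable if there is a word $w$ over the alphabet $V$ such that for all distinct $x,y\in V$, $x$ and $y$ alternate in $w$ if and only if $xy\in E$. *)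

(* Defs.v *)
From mathcomp Require Import all_boot ssrint.

Set Implicit Arguments.
Unset Strict Implicit.
Unset Printing Implicit Defensive.

(* The word x y x y ... of length l. *)
Definition alt_word (T : Type) (x y : T) (l : nat) : seq T :=
  mkseq (fun i => if odd i then y else x) l.

Definition alternate (T : eqType) (x y : T) (w : seq T) : Prop :=
  exists l : nat,
    [seq z <- w | (z == x) || (z == y)] = alt_word x y l \/
    [seq z <- w | (z == x) || (z == y)] = alt_word y x l.

(* Letters of V are allowed to be absent from w; this does not enlarge the
   class of graphs, since prepending one copy of every absent letter to w
   leaves all alternations unchanged. *)
Definition word_representable (V : finType) (e : rel V) : Prop :=
  exists w : seq V, forall x y : V, x != y -> (alternate x y w <-> e x y).

(* The vertex of [n] = {1, ..., n} with number v is the element of 'I_n with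
   value v.-1, and the letter a_r is nth false a r.-1, so r : 'I_(size a)
   below stands for the position r.+1; `|x - y|%N is the distance in nat. *)
Definition toeplitz_graph (n : nat) (a : seq bool) : rel 'I_n :=
  fun x y => (x != y) &&
    [exists r : 'I_(size a),
      (r.+1 == `|x - y|%N %[mod size a]) && nth false a r].
Arguments toeplitz_graph n a : clear implicits.

Definition one_zero_word (k m : nat) : seq bool :=
  nseq (k - 1) true ++ [:: false] ++ nseq (m - k) true.

(* Main.v *)
Require Import Defs.
From mathcomp Require Import all_boot.
From mathcomp Require Import ssrint zify.

(* For x < y, the vertices x and y are nonadjacent iff y = x + k mod m.

   If gcd(k, m) = 1, the residue classes modulo m form a single cycle
   C_0, ..., C_(m-1) under adding k, and x in C_i, y in C_(i+1) (indices mod m)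
   are nonadjacent iff x < y.  Write every class in decreasing order.  In the
   word C_0 ... C_(m-1) C_0 ... C_(m-1) all pairs alternate; advancing the
   second copy of C_j so that it is merged, in decreasing order, with the copy
   of C_(j-1) written just before it destroys the alternation of exactly the
   nonadjacent pairs between C_(j-1) and C_j.  Concatenating these words for
   j = 0, ..., m-1 represents the graph; for j = 0 the second C_0 is merged with
   the first C_(m-1), which is how the cycle closes up.

   If m = 2k, every class is nonadjacent exactly to its shift by k; listing the
   classes twice, with the two members of each such pair consecutive and
   exchanged the second time, represents the graph. *)

Set Implicit Arguments.
Unset Strict Implicit.
Unset Printing Implicit Defensive.

(** * Alternation as absence of equal neighbours *)

Lemma alt_wordS (T : Type) (x y : T) (l : nat) :
  alt_word x y l.+1 = x :: alt_word y x l.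
Proof.
rewrite /alt_word /mkseq /= -[1]/(1 + 0) iotaDl -map_comp; congr (_ :: _).
by apply: eq_map => i /=; case: (odd i).
Qed.

Lemma sorted_alt_word (T : eqType) (x y : T) (l : nat) :
  x != y -> sorted (fun a b => a != b) (alt_word x y l).
Proof.
elim: l x y => [|l IHl] x y xy //; have yx : y != x by rewrite eq_sym.
move: (IHl y x yx); rewrite alt_wordS; case: l {IHl} => [|l] //.
by rewrite alt_wordS /= xy.
Qed.

Lemma path_neq_alt_word (T : eqType) (x y : T) (s : seq T) :
  all (pred2 x y) s -> path (fun a b => a != b) x s ->
  x :: s = alt_word x y (size s).+1.
Proof.
elim: s x y => [|z s IHs] x y //= /andP[/orP[]/eqP-> s_xy] /andP[].
  by rewrite eqxx.
move=> _ ps; rewrite alt_wordS -IHs //.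
by apply: sub_all s_xy => u /=; rewrite orbC.
Qed.

(** Unlike the explicit form [alt_word], sortedness passes to factors of [w], so one bad factor
    refutes alternation. *)
Lemma alternateP (T : eqType) (x y : T) (w : seq T) : x != y ->
  alternate x y w <->
  sorted (fun a b => a != b) [seq z <- w | (z == x) || (z == y)].
Proof.
move=> xy; split=> [[l [->|->]]|].
- exact: sorted_alt_word.
- by apply: sorted_alt_word; rewrite eq_sym.
rewrite /alternate; set f := filter _ w; have: all (pred2 x y) f by exact: filter_all.
case: f => [|z s] /=; first by exists 0; left.
case/andP=> /orP[]/eqP-> sxy ps; exists (size s).+1; [left|right].
  exact: path_neq_alt_word.
apply: path_neq_alt_word ps.
by apply: sub_all sxy => u /=; rewrite orbC.
Qed.

Lemma alternateC (T : eqType) (x y : T) (w : seq T) :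
  alternate x y w <-> alternate y x w.
Proof.
have E u v : alternate u v w -> alternate v u w.
  case=> l H; exists l; rewrite (eq_filter (a2 := fun z => (z == u) || (z == v))).
    by case: H; [right | left].
  by move=> z /=; rewrite orbC.
by split; apply: E.
Qed.

(** * Words written from a timetable *)

Section Timetables.

Variable n : nat.
Implicit Types (p q : nat * 'I_n) (a b : 'I_n -> nat) (x y : 'I_n).

Definition slot_le p q : bool :=
  (p.1 < q.1) || ((p.1 == q.1) && (q.2 <= p.2)).

Definition slot_lt p q : bool :=
  (p.1 < q.1) || ((p.1 == q.1) && (q.2 < p.2)).

Lemma slot_ltW p q : slot_lt p q -> slot_le p q.
Proof. rewrite /slot_le /slot_lt; lia. Qed.

Lemma slot_le_total : total slot_le.
Proof. move=> p q; rewrite /slot_le; lia. Qed.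

Lemma slot_le_trans : transitive slot_le.
Proof. move=> p q r; rewrite /slot_le; lia. Qed.

Lemma slot_le_anti : antisymmetric slot_le.
Proof.
move=> [s x] [t y]; rewrite /slot_le /= => H.
have -> : s = t by lia.
by congr pair; apply: val_inj => /=; lia.
Qed.

(* Each vertex [x] is written twice, in the slots [a x] and [b x]; inside a
   slot the vertices are written in decreasing order. *)
Definition timetable_word a b : seq 'I_n :=
  [seq p.2 | p <- sort slot_le ([seq (a x, x) | x <- enum 'I_n] ++
                                [seq (b x, x) | x <- enum 'I_n])].

(** Filtering commutes with sorting, so only the order of the four slots of [x] and [y] matters; [s]
    is that order. *)
Lemma filter_timetable_word a b x y (s : seq (nat * 'I_n)) : x != y ->
  sorted slot_lt s ->
  perm_eq s [:: (a x, x); (a y, y); (b x, x); (b y, y)] ->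
  [seq z <- timetable_word a b | (z == x) || (z == y)] = [seq p.2 | p <- s].
Proof.
move=> xy s_sorted s_perm.
rewrite filter_map (filter_sort slot_le_total slot_le_trans).
congr (map _); rewrite filter_cat.
have E (f : 'I_n -> nat) : perm_eq
    [seq p <- [seq (f u, u) | u <- enum 'I_n] | (p.2 == x) || (p.2 == y)]
    [:: (f x, x); (f y, y)].
  rewrite filter_map -[X in perm_eq _ X]/(map (fun u => (f u, u)) [:: x; y]).
  apply/perm_map/uniq_perm; first exact/filter_uniq/enum_uniq.
    by rewrite /= inE xy.
  by move=> u; rewrite mem_filter mem_enum !inE andbT.
apply: (sorted_eq slot_le_trans slot_le_anti).
- exact: (sort_sorted slot_le_total).
- by apply: sub_sorted s_sorted => p q; exact: slot_ltW.
by rewrite perm_sort (perm_trans (perm_cat (E a) (E b))) // perm_sym.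
Qed.

(** Every block restricts to x y x y, and such blocks concatenate to an alternating word. *)
Lemma timetable_words_alternating (I : eqType) a (b : I -> 'I_n -> nat)
    (js : seq I) x y : x != y -> slot_lt (a x, x) (a y, y) ->
  {in js, forall j, slot_lt (a y, y) (b j x, x) /\ slot_lt (b j x, x) (b j y, y)} ->
  alternate x y (flatten [seq timetable_word a (b j) | j <- js]).
Proof.
move=> xy axy H; exists (4 * size js); left.
elim: js H => [|j js IHjs] H //=.
have [ayx bxy] := H j (mem_head _ _).
rewrite filter_cat IHjs => [|i ijs]; last by apply: H; rewrite inE ijs orbT.
rewrite (@filter_timetable_word _ _ _ _ [:: (a x, x); (a y, y); (b j x, x); (b j y, y)]) //.
  by rewrite mulnS !addSn add0n !alt_wordS.
by rewrite /= axy ayx bxy.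
Qed.

(** Block [j] restricts to x x y y or x y y x, which repeats a letter. *)
Lemma timetable_words_not_alternating (I : eqType) a (b : I -> 'I_n -> nat)
    (js : seq I) (j : I) x y : x != y -> j \in js ->
  sorted slot_lt [:: (a x, x); (b j x, x); (a y, y); (b j y, y)] \/
  sorted slot_lt [:: (a x, x); (a y, y); (b j y, y); (b j x, x)] ->
  ~ alternate x y (flatten [seq timetable_word a (b j) | j <- js]).
Proof.
move=> xy jjs H /(alternateP _ xy).
case/splitPr: js / jjs => js1 js2.
rewrite map_cat flatten_cat /= !filter_cat => /cat_sorted2[_ /cat_sorted2[+ _]].
case: H => /filter_timetable_word H; rewrite (H a (b j) x y) //= ?eqxx ?andbF //.
- by apply/permP => P /=; lia.
- by apply/permP => P /=; lia.
Qed.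

Lemma timetable_word_representable (e : rel 'I_n) (I : eqType) a
    (b : I -> 'I_n -> nat) (js : seq I) : symmetric e ->
  (forall x y, x != y -> slot_lt (a x, x) (a y, y) ->
     if e x y then
       {in js, forall j, slot_lt (a y, y) (b j x, x) /\
                         slot_lt (b j x, x) (b j y, y)}
     else exists2 j, j \in js &
       sorted slot_lt [:: (a x, x); (b j x, x); (a y, y); (b j y, y)] \/
       sorted slot_lt [:: (a x, x); (a y, y); (b j y, y); (b j x, x)]) ->
  word_representable e.
Proof.
move=> e_sym H; exists (flatten [seq timetable_word a (b j) | j <- js]).
have W x y : x != y -> slot_lt (a x, x) (a y, y) ->
    alternate x y (flatten [seq timetable_word a (b j) | j <- js]) <-> e x y.
  move=> xy axy; have := H _ _ xy axy; case: ifP => _ => [Hj | [j jjs Hj]].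
    by split=> // _; apply: timetable_words_alternating.
  by split=> // /(timetable_words_not_alternating xy jjs Hj).
move=> x y xy; have [/W|ayx] := boolP (slot_lt (a x, x) (a y, y)); first exact.
rewrite alternateC e_sym; apply: W; first by rewrite eq_sym.
move: xy ayx; rewrite -val_eqE /slot_lt /=; lia.
Qed.

End Timetables.

(** * Adjacency expressed by congruences *)

Lemma toeplitz_graph_one_zero_word (k m n : nat) (x y : 'I_n) :
  0 < k -> k < m ->
  toeplitz_graph n (one_zero_word k m) x y =
  (x != y) && (`|x - y|%N != k %[mod m]).
Proof.
move=> k_gt0 k_lt_m; rewrite /toeplitz_graph.
have sz : size (one_zero_word k m) = m.
  by rewrite /one_zero_word !size_cat !size_nseq /=; lia.
have nthE r : r < m -> nth false (one_zero_word k m) r = (r.+1 != k).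
  move=> rm; rewrite /one_zero_word !nth_cat /= !nth_nseq size_nseq.
  case: ltnP => r1; first lia.
  case: ltnP => r2; last by rewrite ifT; lia.
  have -> : r - (k - 1) = 0 by lia.
  by rewrite /=; lia.
congr (_ && _); set d := `|_ - _|%N.
apply/existsP/idP => [[r]|dk].
  case: r => r /= rs /andP[/eqP]; have rm : r < m by rewrite -sz.
  rewrite sz nthE // => rd; rewrite -rd; apply: contraNN => /eqP.
  have [->|r1m] := eqVneq r.+1 m; first by rewrite modnn modn_small //; lia.
  by rewrite !modn_small //; lia.
have m_gt0 : 0 < m by lia.
(* Letters are numbered from 1 but indexed from 0: residue 0 is read at the last letter. *)
pose r := if d %% m == 0 then m.-1 else (d %% m).-1.
have dm := ltn_pmod d m_gt0.
have rm : r < size (one_zero_word k m) by rewrite sz /r; case: ifP; lia.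
exists (Ordinal rm); rewrite nthE /=; last by rewrite -[X in _ < X]sz.
move: dk; rewrite /= sz (modn_small k_lt_m) /r; case: ifP => [/eqP d0|d0] dk.
  by rewrite prednK // modnn d0 eqxx; lia.
by rewrite prednK ?lt0n ?d0 // modn_mod eqxx.
Qed.

Lemma toeplitz_graph_sym (n : nat) (a : seq bool) :
  symmetric (toeplitz_graph n a).
Proof. by move=> x y; rewrite /toeplitz_graph eq_sym distnC. Qed.

Lemma toeplitz_graph_one_zero_wordE (k m n : nat) (x y : 'I_n) :
  0 < k -> k < m ->
  toeplitz_graph n (one_zero_word k m) x y =
  (x != y) && ~~ ((x < y) && (y == x + k %[mod m]) ||
                  (y < x) && (x == y + k %[mod m])).
Proof.
move=> k_gt0 k_lt_m; rewrite toeplitz_graph_one_zero_word // -val_eqE /=.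
have E (i j : nat) : i < j -> (`|i - j|%N == k %[mod m]) = (j == i + k %[mod m]).
  by move=> ij; rewrite distnEr ?(ltnW ij) // -(eqn_modDl i) subnKC // ltnW.
by case: ltngtP => //= xy; [rewrite orbF (E _ _ xy) | rewrite distnC (E _ _ xy)].
Qed.

(** * The coprime case *)

Lemma coprime_inv_mod (k m : nat) : 0 < k -> coprime k m ->
  exists u, u * k = 1 %[mod m].
Proof.
move=> k_gt0 /eqP co; have [u v + _] := egcdnP m k_gt0; rewrite co => E.
by exists u; rewrite E modnMDl.
Qed.

Lemma toeplitz_coprime_word_representable (k m n : nat) :
  0 < k -> k < m -> coprime k m ->
  word_representable (toeplitz_graph n (one_zero_word k m)).
Proof.
move=> k_gt0 k_lt_m co; have m_gt1 : 1 < m by lia.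
have m_gt0 : 0 < m by lia.
have [u uk] := coprime_inv_mod k_gt0 co.
(* As [u] inverts [k] modulo [m], adding [k] to [x] advances [c x] by one cyclically: [c x] is the
   index of the class of [x]. *)
pose c (x : 'I_n) := (x * u) %% m.
have c_lt x : c x < m by rewrite ltn_pmod.
have c_succ (x y : 'I_n) :
    (y == x + k %[mod m]) =
    (c y == (c x).+1) || (c x == m.-1) && (c y == 0).
  have -> : (c y == (c x).+1) || (c x == m.-1) && (c y == 0) =
            (c y == (c x).+1 %% m).
    have := c_lt x; have := c_lt y; case: (eqVneq (c x) m.-1) => [->|cx] *.
      by rewrite prednK // modnn; lia.
    by rewrite modn_small; lia.
  rewrite -addn1 /c modnDml; apply/eqP/eqP => E.
    by rewrite -modnMml E modnMml mulnDl -modnDmr [k * u]mulnC uk modnDmr.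
  rewrite -[y : nat]muln1 -modnMmr -uk modnMmr mulnA -modnMml E modnMml.
  by rewrite mulnDl mul1n -mulnA -modnDml -modnMmr uk modnMmr muln1 modnDml.
(* In word [j] the second copy of class [j] moves one slot earlier; for [j = 0] this is slot
   [m - 1], that of the first copy of the last class. *)
apply: (@timetable_word_representable n _ nat c
          (fun j x => m + c x - (c x == j)) (iota 0 m)).
  exact: toeplitz_graph_sym.
move=> x y /negbTE xy; rewrite toeplitz_graph_one_zero_wordE // !c_succ xy /=.
have := c_lt x; have := c_lt y; move: xy; rewrite -val_eqE /slot_lt /=.
move: (c x) (c y) => cx cy xy cy_lt cx_lt lt_xy.
case: ifP => [e_xy j _ | e_xy].
  by split; lia.
(* If [y < x], nonadjacency forces [cx = 0] and [cy = m - 1], and word 0 gives x x y y. Otherwise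
   [cy = cx + 1], and word [cy] gives x y y x. *)
case: (ltnP y x) => yx.
  by exists cx; [rewrite mem_iota | left]; lia.
by exists cy; [rewrite mem_iota | right]; lia.
Qed.

(** * The case of m = 2k *)

Lemma modn_double (k x : nat) : 0 < k ->
  x %% (2 * k) = odd (x %/ k) * k + x %% k.
Proof.
move=> k_gt0.
have {1}-> : x = (x %/ k)./2 * (2 * k) + (odd (x %/ k) * k + x %% k).
  rewrite {1}(divn_eq x k) -{1}(odd_double_half (x %/ k)) -mul2n; lia.
rewrite modnMDl modn_small //.
by have := ltn_pmod x k_gt0; case: odd; lia.
Qed.

Lemma toeplitz_half_word_representable (k n : nat) : 0 < k ->
  word_representable (toeplitz_graph n (one_zero_word k (2 * k))).
Proof.
move=> k_gt0.
(* [r] names a pair of classes swapped by adding [k], and [h] the member of the pair. *)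
pose r (x : 'I_n) := x %% k; pose h (x : 'I_n) := odd (x %/ k).
have r_lt x : r x < k by rewrite ltn_pmod.
have shift (x y : 'I_n) :
    (y == x + k %[mod 2 * k]) = (r y == r x) && (h y != h x).
  rewrite !modn_double // divnDr // divnn k_gt0 modnDr addn1 /= -/(r x) -/(r y).
  rewrite -/(h x) -/(h y); have := r_lt x; have := r_lt y.
  by case: (h x); case: (h y) => /=; lia.
(* A single word suffices; negating [h] exchanges the two members in the second half. *)
apply: (@timetable_word_representable n _ unit (fun x => 2 * r x + h x)
          (fun _ x => 2 * k + 2 * r x + ~~ h x) [:: tt]).
  exact: toeplitz_graph_sym.
move=> x y /negbTE xy; rewrite toeplitz_graph_one_zero_wordE //; last by lia.
rewrite !shift xy /=; have := r_lt x; have := r_lt y.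
move: xy; rewrite -val_eqE /slot_lt /=.
move: (r x) (r y) (h x) (h y) => rx ry hx hy xy ry_lt rx_lt lt_xy.
case: ifP => [e_xy j _ | e_xy]; first by split; lia.
by exists tt => //; right; lia.
Qed.

Theorem theorem7 (k m : nat) (k_gt0 : 0 < k) (k_lt_m : k < m)
    (km : gcdn k m = 1 \/ (~~ odd m /\ k = m %/ 2)) (n : nat) (n_gt0 : 0 < n) :
  word_representable (toeplitz_graph n (one_zero_word k m)).
Proof.
case: km => [/eqP co|[m_even km]].
  exact: toeplitz_coprime_word_representable.
have -> : m = 2 * k by lia.
exact: toeplitz_half_word_representable.
Qed.
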